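(* Let $M \ge 2$ be an integer, let $\mathcal A \subset \{0, \dots, M-1\}$ be nonempty, and let $\chi \in \mathcal G^s_{c}((0,1))$ for some $s > 1$, with values in $[0,1]$. Let $B_N$ be the associated quantum open baker's map, $\mathcal N_N(\nu)$ its eigenvalue counting function, and $\delta = \frac{\log|\mathcal A|}{\log M}$. Then there is a constant $C$ depending only on $\chi$ and $M$ such that for all $\nu \ge 1$ and all sufficiently large $N = KM$ with $K \in \mathbb N$, $$\mathcal N_N(\nu) \le C N^\delta \nu^{(1-\delta)s}.$$
   Context: For $N \in \mathbb N$, $\mathbb Z_N = \mathbb Z/N\mathbb Z \simeq \{0,\dots,N-1\}$ and $\ell^2_N = \ell^2(\mathbb Z_N)$. The unitary discrete Fourier transform is $\mathcal F_N u(j) = N^{-1/2}\sum_{\ell=0}^{N-1} e^{-2\pi i j\ell/N} u(\ell)$. Let $N = KM$ with $K \in \mathbb N$. For $a \in \{0,\dots,M-1\}$ define $\Pi_a : \ell^2_N \to \ell^2_K$ by $\Pi_a u(j) = u(j + aK)$, $j \in \{0,\dots,K-1\}$. The quantum open baker's map is $$B_N = \sum_{a \in \mathcal A} \mathcal F_N^* \Pi_a^* \chi_K \mathcal F_K \chi_K \Pi_a,$$ where $\chi_K$ is multiplication by $j \mapsto \chi(j/K)$ on $\ell^2_K$. For $\nu \ge 0$, $\mathcal N_N(\nu)$ is the number of eigenvalues $\lambda$ of $B_N$ with $|\lambda| \ge M^{-\nu}$, counted with multiplicity. For $s>1$, $\mathcal G^s_c((0,1))$ is the set of $f \in C_c^\infty(\mathbb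 R)$ with $\operatorname{supp} f \subset (0,1)$ that are $s$-Gevrey: for every compact $K' \subset \mathbb R$ there is $C_{K',f}$ with $\sup_{x \in K'}|\partial^\alpha f(x)| \le C_{K',f}^{\alpha+1}(\alpha!)^s$ for all integers $\alpha \ge 0$. *)

(* Defs.v *)
From mathcomp Require Import all_boot all_order all_algebra.
From mathcomp Require Import all_classical all_reals all_analysis.
From mathcomp.real_closed Require Import complex.
Set Implicit Arguments. Unset Strict Implicit. Unset Printing Implicit Defensive.
Import Order.TTheory GRing.Theory Num.Theory.
Import numFieldNormedType.Exports.
Local Open Scope classical_set_scope.
Local Open Scope ring_scope.
Local Open Scope complex_scope.

Section Baker.
Variable R : realType.

Definition expi (t : R) : R[i] := (cos t +i* sin t).

Definition dft (n : nat) : 'M[R[i]]_n :=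
  \matrix_(p, q)
    (((Num.sqrt (n%:R : R))^-1)%:C * expi (- (2 * pi * (p%:R * q%:R) / n%:R))).

Definition adjmx (m n : nat) (A : 'M[R[i]]_(m, n)) : 'M[R[i]]_(n, m) :=
  \matrix_(p, q) conjc (A q p).

Definition proj_a (K M : nat) (a : nat) : 'M[R[i]]_(K, K * M) :=
  \matrix_(j, m) (((m : nat) == j + a * K)%N)%:R.

Definition cutoff_mx (K : nat) (chi : R -> R) : 'M[R[i]]_K :=
  diag_mx (\row_(j < K) (chi (j%:R / K%:R))%:C).

Definition baker (M K : nat) (A : {set 'I_M}) (chi : R -> R) : 'M[R[i]]_(K * M) :=
  \sum_(a in A)
    adjmx (dft (K * M)) *m adjmx (proj_a K M a) *m cutoff_mx K chi
      *m dft K *m cutoff_mx K chi *m proj_a K M a.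

(* the eigenvalues of a complex square matrix, listed with (algebraic)
   multiplicity: the roots of its characteristic polynomial *)
Definition eigenvalues (n : nat) (B : 'M[R[i]]_n) : seq R[i] :=
  projT1 (closed_field_poly_normal (char_poly B)).

Definition eig_count (n : nat) (B : 'M[R[i]]_n) (t : R) : nat :=
  count (fun z : R[i] => t%:C <= `|z|) (eigenvalues B).

Definition counting_fn (M K : nat) (A : {set 'I_M}) (chi : R -> R) (nu : R) : nat :=
  eig_count (baker K A chi) (powR (M%:R : R) (- nu)).

Definition gevrey_c01 (s : R) (f : R -> R) : Prop :=
  (forall (n : nat) (x : R), derivable (derive1n n f) x 1) /\
  compact (closure [set x | f x != 0]) /\
  closure [set x | f x != 0] `<=` (`]0, 1[%classic) /\
  (forall K' : set R, compact K' ->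
     exists C : R, forall (alpha : nat) (x : R), K' x ->
       `|derive1n alpha f x| <= C ^+ alpha.+1 * powR ((factorial alpha)%:R) s).

End Baker.

(* Main.v *)
Require Import Defs.
From mathcomp Require Import all_boot all_order all_algebra.
From mathcomp Require Import all_classical all_reals all_analysis.
From mathcomp.real_closed Require Import complex.
From mathcomp Require Import perm.
From mathcomp Require Import ring lra zify.
Import Order.TTheory GRing.Theory Num.Theory.
Set Implicit Arguments. Unset Strict Implicit. Unset Printing Implicit Defensive.
Import numFieldNormedType.Exports.
Import Normc.
Local Open Scope ring_scope.
Local Open Scope complex_scope.

(** If [V] spans an invariant subspace of [B] carrying [m] prescribed
    eigenvalues, expanding a maximal weighted minor of [V *m B] shows that the
    product of these eigenvalues is at most a product of [m] distinct weighted
    column sums [sum_j |B j l| w j / w l], for any positive weight [w].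

    Summation by parts and the Gevrey bounds make the kernel of the baker's map
    decay off the graph of the expanding map [x |-> M x - a]: it is at most
    [(n + 1) C^(n+1) n!^s / t^n] at distance [t], for every [n].  Take
    [w = (W + d)^-p], where [d] is the distance (in units of [1 / N]) to a
    finite stage of the Cantor set with digits in [A], [p] is of order [nu] and
    [W] of order [p^s].  The expanding map multiplies [d] by at least [M], so a
    column at distance [d > W] gains a factor exponentially small in [p], while
    the Gevrey decay absorbs the growth of the weight along the tails.  Hence the
    number of eigenvalues is at most a constant times the number of positions
    with [d <= W].  The stage is chosen with intervals of length about [W], so
    there are at most a constant times [(N / W)^delta W] of them. *)

(** * Products of eigenvalues and weighted column sums *)

Lemma char_poly_similar (F : fieldType) n (P B : 'M[F]_n) :
  P \in unitmx -> char_poly (P *m B *m invmx P) = char_poly B.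
Proof.
move=> uP; rewrite /char_poly /char_poly_mx.
have -> : 'X%:M - map_mx polyC (P *m B *m invmx P) =
  map_mx polyC P *m ('X%:M - map_mx polyC B) *m map_mx polyC (invmx P).
  rewrite mulmxBr mulmxBl -!map_mxM mul_mx_scalar -scalemxAl -map_mxM mulmxV //.
  by rewrite map_mx1 scalemx1.
rewrite !det_mulmx mulrAC -det_mulmx -map_mxM mulmxV //.
by rewrite map_mx1 det1 mul1r.
Qed.

Lemma char_poly_lblock (F : fieldType) n1 n2 (A : 'M[F]_n1) (C : 'M[F]_(n2, n1))
    (D : 'M[F]_n2) :
  char_poly (block_mx A 0 C D) = char_poly A * char_poly D.
Proof.
rewrite /char_poly /char_poly_mx scalar_mx_block map_block_mx opp_block_mx.
by rewrite add_block_mx map_mx0 subr0 det_lblock.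
Qed.

Lemma char_poly_scalar1 (F : fieldType) (z : F) :
  char_poly (z%:M : 'M[F]_1) = 'X - z%:P.
Proof.
by rewrite /char_poly /char_poly_mx map_scalar_mx -raddfB det_scalar1.
Qed.

(** Deflation: a left eigenvector completed to a basis makes [B] block triangular, and the trailing
    block has the characteristic polynomial with one factor removed. Triangularising rather than
    diagonalising respects algebraic multiplicities. *)
Lemma invariant_rows (F : fieldType) (s : seq F) n (B : 'M[F]_n) (q : {poly F}) :
  char_poly B = (\prod_(z <- s) ('X - z%:P)) * q ->
  exists V : 'M[F]_(size s, n), exists T : 'M[F]_(size s),
    [/\ row_free V, V *m B = T *m V & \det T = \prod_(z <- s) z].
Proof.
elim: s n B => [|z s IH] n B.
  move=> _; exists 0, 0; split; last by rewrite det_mx00 big_nil.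
    by rewrite /row_free mxrank0.
  by rewrite !mul0mx.
rewrite big_cons -mulrA => hB.
have : eigenvalue B z by rewrite eigenvalue_root_char hB rootM root_XsubC eqxx.
case/eigenvalueP=> v hv v0.
case: n B hB v hv v0 => [|n] B hB v hv v0.
  by move: v0; rewrite [v]thinmx0 eqxx.
change (n.+1) with (1 + n)%N in (type of B), (type of v).
(* Since [v] has rank 1, the first row [e] of this invertible matrix is proportional to [v]. *)
pose P : 'M[F]_(1 + n) := row_ebase v.
have uP : P \in unitmx by exact: row_ebase_unit.
pose e : 'M[F]_(1, 1 + n) := row_mx 1%:M 0 *m P.
have ve : v = col_ebase v *m e.
  rewrite /e -{1}(mulmx_ebase v) -mulmxA; congr (_ *m (_ *m _)).
  have -> : \rank v = 1 by apply/eqP; rewrite rank_rV v0.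
  by rewrite (@pid_mx_row F n 1).
have he : e *m B = z *: e.
  have -> : e = invmx (col_ebase v) *m v by rewrite {2}ve mulKmx // col_ebase_unit.
  by rewrite -mulmxA hv -scalemxAr.
pose B1 := P *m B *m invmx P.
have u1 : usubmx B1 = z *: row_mx 1%:M 0.
  have -> : usubmx B1 = row_mx 1%:M 0 *m B1.
    by rewrite -{2}[B1]vsubmxK mul_row_col mul1mx mul0mx addr0.
  by rewrite /B1 !mulmxA -/e he -scalemxAl /e mulmxK.
have hB1 : B1 = block_mx z%:M 0 (dlsubmx B1) (drsubmx B1).
  rewrite -{1}[B1]submxK /ulsubmx /ursubmx u1 linearZ /= row_mxKl linearZ /=.
  by rewrite row_mxKr scalemx1 scaler0.
have hc : char_poly (drsubmx B1) = \prod_(j <- s) ('X - j%:P) * q.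
  have := char_poly_similar B uP; rewrite -/B1 {1}hB1 char_poly_lblock.
  rewrite char_poly_scalar1 hB; apply/mulfI.
  by rewrite polyXsubC_eq0.
have [V' [T' [fV hV hT]]] := IH _ _ hc.
pose V0 : 'M[F]_(1 + size s, 1 + n) := block_mx 1%:M 0 0 V'.
have rV0 : \rank V0 = (1 + size s)%N by rewrite rank_diag_block_mx mxrank1 (eqP fV).
pose T : 'M[F]_(1 + size s) := block_mx z%:M 0 (V' *m dlsubmx B1) T'.
have V0B1 : V0 *m B1 = T *m V0.
  rewrite {1}hB1 /V0 !mulmx_block !mul0mx !mulmx0 !mulmx1 !mul1mx !addr0 !add0r.
  by rewrite hV.
have VB : V0 *m P *m B = T *m (V0 *m P).
  by rewrite mulmxA -V0B1 /B1 -!mulmxA mulVmx // mulmx1.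
have dT : \det T = z * \prod_(j <- s) j by rewrite det_lblock det_scalar1 hT.
exists (V0 *m P), T; split; [|exact: VB|by rewrite big_cons].
rewrite /row_free mxrankMfree; last by rewrite row_free_unit.
by apply/eqP; exact: rV0.
Qed.

(** Cauchy-Binet before grouping. Keeping all maps [f], including the non-injective ones whose minor
    vanishes, lets the sum of products factor column by column later. *)
Lemma det_mulmx_expand (F : comPzRingType) n m (V : 'M[F]_(n, m)) (C : 'M[F]_(m, n)) :
  \det (V *m C) =
    \sum_(f : {ffun 'I_n -> 'I_m}) (\prod_i C (f i) i) * \det (colsub f V).
Proof.
rewrite -[LHS]det_tr {1}/determinant.
transitivity (\sum_(f : {ffun 'I_n -> 'I_m}) \sum_(t : {perm 'I_n})
   (-1) ^+ t * \prod_i (V (t i) (f i) * C (f i) i)).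
  rewrite exchange_big /=; apply: eq_bigr => t _.
  rewrite -big_distrr /=; congr (_ * _).
  rewrite -(bigA_distr_bigA (fun i j => V (t i) j * C j i)).
  by apply: eq_bigr => i _; rewrite !mxE.
apply: eq_bigr => f _; rewrite -det_tr /determinant big_distrr /=.
apply: eq_bigr => t _; rewrite big_split /= mulrCA mulrA mulrC; congr (_ * _).
by rewrite mulrC; congr (_ * _); apply: eq_bigr => i _; rewrite !mxE.
Qed.

(* [J] indexes the minor of [V] that is maximal relative to the weight [w];
   expanding the minor of [V *m B] along the same columns bounds [\det T]. *)
Lemma invariant_det_bound (F : numFieldType) n m (V : 'M[F]_(n, m)) (B : 'M[F]_m)
    (T : 'M[F]_n) (w : 'I_m -> F) :
  (forall l, 0 < w l) -> row_free V -> V *m B = T *m V ->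
  exists2 J : 'I_n -> 'I_m, injective J &
    `|\det T| <= \prod_i \sum_l `|B l (J i)| * w l / w (J i).
Proof.
move=> w0 fV hVB.
pose g (f : {ffun 'I_n -> 'I_m}) : F := `|\det (colsub f V)| / \prod_i w (f i).
have P0 (f : {ffun 'I_n -> 'I_m}) : 0 < \prod_i w (f i) by apply: prodr_gt0.
have g0 f : 0 <= g f by rewrite divr_ge0 // ltW.
(* Independent rows leave some nonzero minor, so the maximum of [g] is positive. *)
have [f0 hf0] : exists f0, 0 < g f0.
  have cV : row_full V^T by rewrite /row_full mxrank_tr.
  pose f0 := [ffun i => fullrankfun cV i].
  exists f0; rewrite divr_gt0 // normr_gt0 -det_tr -unitfE.
  have -> : (colsub f0 V)^T = rowsub (fullrankfun cV) V^T.
    by apply/matrixP => i j; rewrite !mxE ffunE.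
  by rewrite -unitmxE -row_full_unit fullrowsub_full.
pose J := [arg max_(f > f0) g f]%O.
have hJ f : g f <= g J.
  rewrite /J; case: real_arg_maxP => // [i _|i _ h]; first by rewrite ger0_real.
  exact: h.
have gJ : 0 < g J by exact: lt_le_trans hf0 (hJ f0).
have dJ : \det (colsub J V) != 0.
  by apply: contraTneq gJ => h; rewrite /g h normr0 mul0r ltxx.
exists J.
  move=> i k eik; apply/eqP; apply: contraNT dJ => nik.
  apply/eqP; rewrite -det_tr; apply: (determinant_alternate nik) => j.
  by rewrite !mxE eik.
have E : \det T * \det (colsub J V) =
    \sum_(f : {ffun 'I_n -> 'I_m}) (\prod_i B (f i) (J i)) * \det (colsub f V).
  rewrite -det_mulmx.
  have -> : T *m colsub J V = V *m colsub J B by rewrite !mulmx_colsub hVB.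
  rewrite det_mulmx_expand; apply: eq_bigr => f _; congr (_ * _).
  by apply: eq_bigr => i _; rewrite mxE.
have D (f : {ffun 'I_n -> 'I_m}) : `|\det (colsub f V)| <= g J * \prod_i w (f i).
  by rewrite -ler_pdivrMr //; exact: hJ.
under eq_bigr do rewrite -mulr_suml.
rewrite big_split /= prodfV ler_pdivlMr // -(ler_pM2l gJ).
have eJ : `|\det (colsub J V)| = g J * \prod_i w (J i) by rewrite /g divfK // gt_eqF.
rewrite mulrCA -eJ -normrM E (le_trans (ler_norm_sum _ _ _)) //.
(* The product of column sums is a sum over all maps [f], which dominates [E] term by term by
   maximality of [J]. *)
rewrite bigA_distr_bigA /= big_distrr /=; apply: ler_sum => f _.
by rewrite normrM normr_prod big_split /= mulrCA ler_wpM2l ?prodr_ge0 //.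
Qed.

(** * Decay of the kernel *)

Section FiniteDifferences.
Variable R : realType.
Implicit Types f : R -> R.

Definition bdiff (h : R) f : R -> R := fun x => f x - f (x - h).

Lemma is_derive_bdiff (h : R) f (df : R -> R) (x : R) :
  (forall y : R, is_derive y 1 f (df y)) -> is_derive x 1 (bdiff h f) (bdiff h df x).
Proof.
move=> fdf; rewrite /bdiff.
have g : is_derive x 1 (fun y : R => y - h) 1.
  by apply: is_derive_eq; rewrite subr0.
have fg : is_derive x 1 (f \o (fun y : R => y - h)) (df (x - h)).
  by apply: is_derive_eq; rewrite mulr1.
exact: is_deriveB.
Qed.

Definition smooth f := forall n (x : R), derivable (derive1n n f) x 1.

Lemma smooth_is_derive f n (x : R) :
  smooth f -> is_derive x 1 (derive1n n f) (derive1n n.+1 f x).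
Proof. by move=> sf; rewrite derive1nS derive1E; apply: DeriveDef. Qed.

Lemma derive1n_bdiff h f n :
  smooth f -> derive1n n (bdiff h f) = bdiff h (derive1n n f).
Proof.
move=> sf; elim: n => [//|n IH]; rewrite derive1nS IH; apply/funext => x.
rewrite derive1E; have H := is_derive_bdiff h x (fun y => smooth_is_derive n y sf).
exact: derive_val.
Qed.

Lemma smooth_bdiff h f : smooth f -> smooth (bdiff h f).
Proof.
move=> sf n x; rewrite derive1n_bdiff //.
by have [] := is_derive_bdiff h x (fun y => smooth_is_derive n y sf).
Qed.

Lemma bdiff_bound (h : R) f (df : R -> R) b x : 0 <= h ->
  (forall y : R, is_derive y 1 f (df y)) -> (forall y, `|df y| <= b) ->
  `|bdiff h f x| <= h * b.
Proof.
move=> h0 fdf bdf; rewrite /bdiff.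
have [||z _ ->] := @MVT_segment R f df (x - h) x.
- by rewrite gerBl.
- by apply: derivable_within_continuous => y _; case: (fdf y).
by rewrite opprB addrCA subrr addr0 normrM mulrC (ger0_norm h0) ler_wpM2l.
Qed.

Lemma iter_bdiff_bound h f n b x : 0 <= h -> smooth f ->
  (forall y, `|derive1n n f y| <= b) ->
  `|iter n (bdiff h) f x| <= h ^+ n * b.
Proof.
move=> h0; elim: n f b x => [|n IH] f b x sf bf; first by rewrite mul1r; exact: bf.
rewrite iterSr exprSr -mulrA; apply: IH; first exact: smooth_bdiff.
move=> y; rewrite derive1n_bdiff //.
by apply: (@bdiff_bound _ _ (derive1n n.+1 f)) => // z; exact: smooth_is_derive.
Qed.

(** Multiplication by [z] shifts the index by one. Both boundary terms vanish with [f], and the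
    range grows by one because the difference still sees [f] one step back. *)
Lemma summation_by_parts (z : R[i]) h f L : 0 <= h ->
  (forall x, x <= 0 -> f x = 0) -> (forall x, L%:R * h <= x -> f x = 0) ->
  (1 - z) * (\sum_(p < L) (f (p%:R * h))%:C * z ^+ p) =
  \sum_(p < L.+1) (bdiff h f (p%:R * h))%:C * z ^+ p.
Proof.
move=> h0 fl fr; rewrite mulrBl mul1r /bdiff.
under [RHS]eq_bigr do rewrite raddfB mulrBl.
rewrite sumrB big_ord_recr /= (fr (L%:R * h)) // mul0r addr0; congr (_ - _).
rewrite big_ord_recl /= mul0r sub0r (fl (- h)) ?oppr_le0 // mul0r add0r.
rewrite mulr_sumr; apply: eq_bigr => i _; rewrite /bump /= exprS mulrCA.
by congr (_ * _); rewrite natrD mulrDl mul1r addrAC subrr add0r.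
Qed.

Lemma iter_summation_by_parts (z : R[i]) h f L n : 0 <= h ->
  (forall x, x <= 0 -> f x = 0) -> (forall x, L%:R * h <= x -> f x = 0) ->
  (1 - z) ^+ n * (\sum_(p < L) (f (p%:R * h))%:C * z ^+ p) =
  \sum_(p < L + n) (iter n (bdiff h) f (p%:R * h))%:C * z ^+ p.
Proof.
move=> h0; elim: n f L => [|n IH] f L fl fr; first by rewrite expr0 mul1r addn0.
rewrite exprSr -mulrA summation_by_parts // IH.
- by rewrite addSnnS; apply: eq_bigr => i _; rewrite iterSr.
- by move=> x x0; rewrite /bdiff !fl ?subrr // subr_le0 (le_trans x0).
- move=> x; rewrite -natr1 mulrDl mul1r => hx; rewrite /bdiff !fr ?subrr //.
    by rewrite lerBrDr.
  by apply: le_trans hx; rewrite lerDl.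
Qed.

(** After [n] summations by parts, each of the [L + n] terms is an [n]-th difference, bounded by the
    mean value theorem. *)
Lemma expsum_bound (z : R[i]) h f L n b : 0 <= h -> `|z| = 1 -> smooth f ->
  (forall x, x <= 0 -> f x = 0) -> (forall x, L%:R * h <= x -> f x = 0) ->
  (forall x, `|derive1n n f x| <= b) ->
  `|1 - z| ^+ n * `|\sum_(p < L) (f (p%:R * h))%:C * z ^+ p| <=
    ((L + n)%:R * (h ^+ n * b))%:C.
Proof.
move=> h0 z1 sf fl fr bf; rewrite -normrX -normrM iter_summation_by_parts //.
rewrite (le_trans (ler_norm_sum _ _ _)) //.
have -> : ((L + n)%:R * (h ^+ n * b))%:C = \sum_(p < L + n) (h ^+ n * b)%:C.
  by rewrite sumr_const card_ord mulr_natl raddfMn.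
apply: ler_sum => p _; rewrite normrM normrX z1 expr1n mulr1.
by rewrite normc_def /= expr0n addr0 sqrtr_sqr lecR iter_bdiff_bound.
Qed.

End FiniteDifferences.

(** * Exponentials and lower bounds for the sine *)

Section Trigonometry.
Variable R : realType.
Implicit Types x y : R.

Lemma normr_normc (z : R[i]) : `|z| = (normc z)%:C.
Proof. by case: z. Qed.

Lemma normc_ge0 (z : R[i]) : 0 <= normc z.
Proof. by case: z => a b; exact: sqrtr_ge0. Qed.

Lemma expiD x y : expi (x + y) = expi x * expi y.
Proof. by rewrite /expi cosD sinD; simpc; congr (_ +i* _); rewrite addrC. Qed.

Lemma expiX x n : expi (n%:R * x) = expi x ^+ n.
Proof.
elim: n => [|n IH]; first by rewrite mul0r /expi cos0 sin0.
by rewrite exprSr -IH -expiD -natr1 mulrDl mul1r.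
Qed.

Lemma normc_expi x : normc (expi x) = 1.
Proof. by rewrite /= cos2Dsin2 sqrtr1. Qed.

Lemma normc_1Bexpi x : normc (1 - expi (2 * x)) = 2 * `|sin x|.
Proof.
have -> : 2 * `|sin x| = `|2 * sin x| by rewrite normrM ger0_norm.
have -> : 2 * x = x + x by rewrite mulr_natl mulr2n.
rewrite -sqrtr_sqr /expi cosD sinD /=; congr (Num.sqrt _).
have := cos2Dsin2 x; set s := sin x; set c := cos x; move: s c => s c e.
have e1 : 1 - (c * c - s * s) = 2 * s ^+ 2 by rewrite -{1}e; ring.
have e2 : (0 - (s * c + c * s)) ^+ 2 = 4 * c ^+ 2 * s ^+ 2 by ring.
have e3 : c ^+ 2 = 1 - s ^+ 2 by rewrite -e addrK.
transitivity ((2 * s ^+ 2) ^+ 2 + 4 * c ^+ 2 * s ^+ 2); first by rewrite -e1 -e2.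
by rewrite e3; ring.
Qed.

(** The derivative of [sin y - y * cos y] is [y * sin y], nonnegative on this interval. *)
Lemma sin_ge_xcos x : 0 <= x <= pi -> x * cos x <= sin x.
Proof.
move=> /andP[x0 xpi].
pose g (y : R) : R := sin y - y * cos y.
have dg (y : R) : is_derive y 1 g (y * sin y).
  apply: is_derive_eq; rewrite /GRing.scale /=; ring.
have [||z] := @MVT_segment R g (fun y => y * sin y) 0 x.
- by [].
- by apply: derivable_within_continuous => y _; case: (dg y).
rewrite in_itv /= => /andP[z0 zx]; rewrite {1 2}/g sin0 mul0r !subr0 => e.
rewrite -subr_ge0 e mulr_ge0 // mulr_ge0 // sin_ge0_pi // z0 /=.
exact: le_trans xpi.
Qed.

(** By the half-angle formula and [sin_ge_xcos], [sin y] is at least [y * cos (y / 2) ^+ 2] for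
    [y >= 0]. The margin [c] keeps [y / 2] away from [pi / 2], so the constant is positive. *)
Lemma norm_sin_ge (c y : R) : 0 < c <= 1 / 2 -> `|y| <= pi * (1 - c) ->
  cos (pi * (1 - c) / 2) ^+ 2 * `|y| <= `|sin y|.
Proof.
move=> /andP[c0 c1]; wlog y0 : y / 0 <= y.
  move=> H; have [/H //|/ltW yn] := leP 0 y.
  by move: (H (- y)); rewrite oppr_ge0 sinN !normrN; exact.
have pi0 := @pi_gt0 R.
rewrite (ger0_norm y0) => yc.
have q0 : 0 <= pi * (1 - c) :> R by nra.
have q1 : pi * (1 - c) <= pi :> R by nra.
have yp : y <= pi by apply: le_trans yc _; nra.
rewrite ger0_norm; last by rewrite sin_ge0_pi // y0.
have y2 : 0 <= y / 2 <= pi by lra.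
have -> : sin y = 2 * cos (y / 2) * sin (y / 2).
  by rewrite -{1}[y](@divfK _ 2) // mulr_natr sin_mulr2n -mulr_natl; ring.
have cc : 0 <= cos (pi * (1 - c) / 2) <= cos (y / 2).
  apply/andP; split.
    by apply: cos_ge0_pihalf; lra.
  have [e|ne] := eqVneq (y / 2) (pi * (1 - c) / 2); first by rewrite e.
  rewrite ltW // ltr_cos ?in_itv /=; [|lra|lra].
  by rewrite lt_neqAle ne /=; lra.
have := sin_ge_xcos y2; set S := sin _; move: cc.
set a := cos (_ * _ / 2); set b := cos _; move=> /andP[a0 ab] h.
have : a ^+ 2 * y <= b ^+ 2 * y by rewrite ler_wpM2r // ler_sqr ?nnegrE // (le_trans a0).
move/le_trans; apply.
have : 0 <= 2 * b by lra.
move=> /(ler_wpM2l) /(_ _ _ h); nra.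
Qed.

End Trigonometry.

(** * Support and derivatives of a Gevrey cutoff *)

Section Gevrey.
Variables (R : realType) (s : R) (f : R -> R).
Hypothesis gf : gevrey_c01 s f.
Local Open Scope classical_set_scope.

(** The closed support avoids a neighbourhood of 0 and one of 1. The margin [c] later serves in
    [norm_sin_ge]. *)
Lemma gevrey_support :
  exists2 c : R, 0 < c <= 1 / 2 & forall x, f x != 0 -> c <= x <= 1 - c.
Proof.
have [_ [_ [sub _]]] := gf; set S := [set x | f x != 0] in sub.
have away (a : R) : ~ (`]0, 1[ : set R) a ->
    exists2 e : R, 0 < e & forall x, f x != 0 -> e <= `|a - x|.
  move=> na; have : nbhs a (~` closure S).
    by apply: open_nbhs_nbhs; split; [exact/closed_openC/closed_closure|move=> /sub].
  move=> /nbhs_ballP[e /= e0 he]; exists e => // x fx.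
  rewrite leNgt; apply/negP => xa.
  by apply: (he x); [exact: xa|exact: subset_closure].
have [|e0 e0p h0] := away 0; first by rewrite /= in_itv /= ltxx.
have [|e1 e1p h1] := away 1; first by rewrite /= in_itv /= ltxx andbF.
exists (Num.min (Num.min e0 e1) (1 / 2)).
  by rewrite !lt_min e0p e1p ge_min lexx orbT /= andbT; lra.
move=> x fx; have : (`]0, 1[ : set R) x by apply: sub; exact: subset_closure.
rewrite /= in_itv /= => /andP[x0 x1].
have := h0 _ fx; rewrite sub0r normrN gtr0_norm // => hx0.
have := h1 _ fx; rewrite gtr0_norm ?subr_gt0 // => hx1.
rewrite !ge_min hx0 /= lerBrDr -lerBrDl !ge_min hx1 orbT //.
Qed.

Lemma derive1n_eq0_off_support n x :
  (~` closure [set x | f x != 0]) x -> derive1n n f x = 0.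
Proof.
have oS : open (~` closure [set x | f x != 0]) by exact/closed_openC/closed_closure.
elim: n x => [|n IH] x hx.
  by apply/eqP; apply: contra_notT hx => fx; exact: subset_closure.
rewrite derive1nS derive1E.
have e : \near x, derive1n n f x = cst 0 x.
  have : nbhs x (~` closure [set x | f x != 0]) by exact: open_nbhs_nbhs.
  by apply: filterS => y /IH.
by rewrite (near_eq_derive _ e) derive_val.
Qed.

(** The Gevrey bound on the compact support is global, since all derivatives vanish off the support.
    Taking the maximum with 1 makes the constant positive. *)
Lemma gevrey_derive_bound :
  exists2 C : R, 1 <= C &
    forall n x, `|derive1n n f x| <= C ^+ n.+1 * powR (n`!%:R) s.
Proof.
have [_ [cS [_ /(_ _ cS)[C hC]]]] := gf.
have m0 : 0 <= Num.max 1 `|C| by rewrite le_max ler01.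
exists (Num.max 1 `|C|); first by rewrite le_max lexx.
move=> n x; have [xS|xS] := pselect (closure [set x | f x != 0] x); last first.
  by rewrite derive1n_eq0_off_support // normr0 mulr_ge0 ?powR_ge0 ?exprn_ge0.
apply: le_trans (hC n x xS) _; rewrite ler_wpM2r ?powR_ge0 //.
apply: le_trans (ler_norm _) _; rewrite normrX lerXn2r ?nnegrE //.
by rewrite le_max lexx orbT.
Qed.

End Gevrey.

(** * Entries of the baker's map *)

Lemma conj_dft (R : realType) n (p q : 'I_n) :
  conjc (dft R n p q) =
    ((Num.sqrt (n%:R : R))^-1)%:C * expi (2 * pi * (p%:R * q%:R) / n%:R).
Proof.
rewrite mxE /expi cosN sinN; apply/eqP; rewrite eq_complex /=.
by rewrite !mul0r !subr0 !addr0 mulrN opprK !eqxx.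
Qed.

Section BakerKernel.
Variables (R : realType) (K M : nat).
Hypothesis K0 : (0 < K)%N.

Definition pos_in (l : 'I_(K * M)) : 'I_K := Ordinal (ltn_pmod l K0).

Lemma block_pos_proof (a : 'I_M) (p : 'I_K) : (p + a * K < K * M)%N.
Proof.
by rewrite (@leq_trans (K + a * K)) // ?ltn_add2r // -mulSn mulnC leq_mul2l ltn_ord orbT.
Qed.
Definition block_pos a p : 'I_(K * M) := Ordinal (block_pos_proof a p).

Lemma mulmx_proj_a m (X : 'M[R[i]]_(m, K)) (a : nat) i (l : 'I_(K * M)) :
  (X *m proj_a R K M a) i l = ((l %/ K)%N == a)%:R * X i (pos_in l).
Proof.
rewrite !mxE (bigD1 (pos_in l)) //= big1 ?addr0 => [|q ql].
  rewrite !mxE /= mulrC; congr (_%:R * _); rewrite {1}(divn_eq l K) addnC.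
  by rewrite eqn_add2l eqn_pmul2r.
rewrite !mxE; case: eqP => e; last by rewrite mulr0.
case/eqP: ql; apply: val_inj => /=.
by rewrite e addnC modnMDl modn_small.
Qed.

Lemma mulmx_adj_proj_a m (Y : 'M[R[i]]_(m, K * M)) (a : 'I_M) i (p : 'I_K) :
  (Y *m adjmx (proj_a R K M a)) i p = Y i (block_pos a p).
Proof.
rewrite !mxE (bigD1 (block_pos a p)) //= big1 ?addr0 => [|q ql].
  by rewrite !mxE /= eqxx conjc1 mulr1.
rewrite !mxE; case: eqP => e; last by rewrite conjc0 mulr0.
by case/eqP: ql; apply: val_inj.
Qed.

(** Only the summand of the block containing [l] survives, because [proj_a] for any other block
    kills the column [l]. *)
Lemma baker_entry (A : {set 'I_M}) chi (j l : 'I_(K * M)) (a : 'I_M) :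
  (l %/ K)%N = a ->
  baker K A chi j l = (a \in A)%:R *
    \sum_(p < K) conjc (dft R (K * M) (block_pos a p) j) *
      (chi (p%:R / K%:R))%:C * dft R K p (pos_in l) *
      (chi ((pos_in l)%:R / K%:R))%:C.
Proof.
move=> la; rewrite /baker summxE.
under eq_bigr => b _ do rewrite mulmx_proj_a la.
have [aA|aA] := boolP (a \in A); last first.
  rewrite mul0r big1 // => b bA; case: eqP => [/val_inj e|]; last by rewrite mul0r.
  by rewrite e bA in aA.
rewrite (bigD1 a) //= eqxx !mul1r big1 ?addr0; last first.
  move=> b /andP[_ ba]; case: eqP => [/val_inj e|]; last by rewrite mul0r.
  by rewrite e eqxx in ba.
rewrite /cutoff_mx mul_mx_diag !mxE mulr_suml; apply: eq_bigr => p _; congr (_ * _).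
by rewrite mul_mx_diag [in LHS]mxE mulmx_adj_proj_a !mxE.
Qed.

Lemma normc_baker (A : {set 'I_M}) (chi : R -> R) (j l : 'I_(K * M)) (a : 'I_M) :
  (0 < M)%N -> (l %/ K)%N = a ->
  let m := (l %% K)%N in
  let z := expi (2 * (pi * ((j%:R - m%:R * M%:R) / (K * M)%:R))) in
  normc (baker K A chi j l) = (a \in A)%:R *
    (Num.sqrt (K * M)%:R)^-1 * (Num.sqrt K%:R)^-1 * `|chi (m%:R / K%:R)| *
    normc (\sum_(p < K) (chi (p%:R * K%:R^-1))%:C * z ^+ p).
Proof.
move=> M0 la m z; rewrite (baker_entry A chi j la).
have nC (x : R) : normc x%:C = `|x| by rewrite /= expr0n addr0 sqrtr_sqr.
pose u := expi (2 * pi * (a * K)%:R * j%:R / (K * M)%:R : R).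
have -> : \sum_(p < K) conjc (dft R (K * M) (block_pos a p) j) *
      (chi (p%:R / K%:R))%:C * dft R K p (pos_in l) *
      (chi ((pos_in l)%:R / K%:R))%:C =
   ((Num.sqrt (K * M)%:R)^-1)%:C * ((Num.sqrt K%:R)^-1)%:C *
   (chi (m%:R / K%:R))%:C * u * \sum_(p < K) (chi (p%:R * K%:R^-1))%:C * z ^+ p.
  rewrite mulr_sumr; apply: eq_bigr => p _; rewrite conj_dft mxE /= -expiX.
  set e1 := expi _; set e2 := expi _; set e3 := expi _.
  (* With [l = a * K + m], the phases of the two Fourier transforms combine into [u], which is
     unimodular and independent of [p], and the frequency [j - m * M]: this is where the expanding
     map appears. *)
  have e : e1 * e2 = u * e3.
    rewrite /e1 /e2 /u /e3 -!expiD; congr expi.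
    rewrite !natrM natrD natrM; field.
    by rewrite !pnatr_eq0 -!lt0n K0 M0.
  transitivity (((Num.sqrt (K * M)%:R)^-1)%:C * ((Num.sqrt K%:R)^-1)%:C *
    (chi (m%:R / K%:R))%:C * (chi (p%:R * K%:R^-1))%:C * (e1 * e2)); last first.
    by rewrite e; ring.
  by rewrite /m /=; ring.
have sK (x : R) : `|(Num.sqrt x)^-1| = (Num.sqrt x)^-1.
  by rewrite ger0_norm // invr_ge0 sqrtr_ge0.
rewrite !normcM !nC normc_expi mulr1 !sK.
have -> : normc ((a \in A)%:R : R[i]) = (a \in A)%:R :> R.
  by case: (a \in A); rewrite ?normc1 ?normc0.
by rewrite !mulrA.
Qed.

(* Off the graph of the expanding map, which sends the position [l] to
   [(l %% K) * M], the kernel decays like the Fourier transform of [chi]. *)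
Lemma baker_decay (s c C : R) (A : {set 'I_M}) (chi : R -> R)
    (j l : 'I_(K * M)) (a : 'I_M) n :
  (0 < M)%N -> (l %/ K)%N = a ->
  0 < c <= 1 / 2 -> (forall x, chi x != 0 -> c <= x <= 1 - c) ->
  1 <= C -> smooth chi -> (forall x, `|chi x| <= 1) ->
  (forall k x, `|derive1n k chi x| <= C ^+ k.+1 * powR (k`!%:R) s) ->
  normc (baker K A chi j l) * `|j%:R - (l %% K)%:R * M%:R| ^+ n <=
    (a \in A)%:R *
    (n.+1%:R * (C * (1 + M%:R / (2 * pi * cos (pi * (1 - c) / 2) ^+ 2))) ^+ n.+1
      * powR (n`!%:R) s).
Proof.
move=> M0 la hc supp C1 smo chi1 der; rewrite (normc_baker _ _ _ M0 la).
have [aA|aA] := boolP (a \in A); last by rewrite !mul0r.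
rewrite !mul1r; set m := (l %% K)%N; set z := expi _; set S := \sum_(p < K) _.
pose t : R := `|j%:R - m%:R * M%:R|; rewrite -/t.
set g := powR _ s; set kap := 2 * pi * _.
have kap0 : 0 < kap.
  have pi0 := @pi_gt0 R; case/andP: hc => c0 c1.
  have cp : 0 < cos (pi * (1 - c) / 2) by apply: cos_gt0_pihalf; apply/andP; split; nra.
  by rewrite /kap !mulr_gt0.
have K0' : 0 < K%:R :> R by rewrite ltr0n.
have M0' : 0 < M%:R :> R by rewrite ltr0n.
have N0' : 0 < (K * M)%:R :> R by rewrite ltr0n muln_gt0 K0.
have g0 : 0 <= g by exact: powR_ge0.
have C0 : 0 <= C by exact: le_trans C1.
have q0 : 0 <= M%:R / kap by rewrite divr_ge0 // ltW.
have RHS0 : 0 <= n.+1%:R * (C * (1 + M%:R / kap)) ^+ n.+1 * g.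
  by rewrite !mulr_ge0 // exprn_ge0 // mulr_ge0 // addr_ge0.
have [->|chim] := eqVneq (chi (m%:R / K%:R)) 0; first by rewrite normr0 mulr0 !mul0r.
have /andP[cm cm'] := supp _ chim.
pose th : R := (j%:R - m%:R * M%:R) / (K * M)%:R.
have zlow : kap * (t / (K * M)%:R) <= normc (1 - z).
  have -> : normc (1 - z) = 2 * `|sin (pi * th)| by exact: normc_1Bexpi.
  have -> : t / (K * M)%:R = `|th| by rewrite /th normrM normfV (gtr0_norm N0').
  have thE : th = j%:R / (K * M)%:R - m%:R / K%:R.
    by rewrite /th natrM; field; rewrite !gt_eqF.
  have j0 : 0 <= j%:R / (K * M)%:R :> R by rewrite divr_ge0 // ltW.
  have j1 : j%:R / (K * M)%:R <= 1 :> R.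
    by rewrite ler_pdivrMr // mul1r ler_nat ltnW.
  (* The cutoff at [m / K] keeps [th] away from 1 and -1, where [z] would return to 1. *)
  have thc : `|th| <= 1 - c by rewrite ler_norml thE; apply/andP; split; lra.
  have pth : `|pi * th| = pi * `|th| by rewrite normrM gtr0_norm // pi_gt0.
  have := @norm_sin_ge R c (pi * th) hc; rewrite pth (ler_pM2l (pi_gt0 R)) => /(_ thc) h.
  by rewrite /kap; move: h; set q := cos _ ^+ 2 => h; nra.
have fl x : x <= 0 -> chi x = 0.
  move=> x0; apply/eqP; apply: contraTT x0 => /supp /andP[cx _].
  by rewrite -ltNge (lt_le_trans _ cx) //; case/andP: hc.
have fr x : K%:R * K%:R^-1 <= x -> chi x = 0.
  rewrite divff ?gt_eqF // => x1; apply/eqP; apply: contraTT x1 => /supp /andP[_ cx].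
  by rewrite -ltNge (le_lt_trans cx) // ltrBlDr ltrDl; case/andP: hc.
have hK : 0 <= K%:R^-1 :> R by rewrite invr_ge0 ltW.
have z1 : `|z| = 1 by rewrite normr_normc normc_expi.
have := expsum_bound hK z1 smo fl fr (der n).
rewrite -/S !normr_normc -rmorphXn -rmorphM lecR => hS.
have S0 := normc_ge0 S.
have t0 : 0 <= t by exact: normr_ge0.
have tS : t ^+ n * normc S <=
    (K + n)%:R * ((M%:R / kap) ^+ n * (C ^+ n.+1 * g)).
  have -> : t ^+ n = ((K * M)%:R / kap) ^+ n * (kap * (t / (K * M)%:R)) ^+ n.
    by rewrite -exprMn; congr (_ ^+ n); field; rewrite !gt_eqF.
  have -> : (M%:R / kap) ^+ n = ((K * M)%:R / kap) ^+ n * K%:R^-1 ^+ n.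
    by rewrite -exprMn natrM; congr (_ ^+ n); field; rewrite !gt_eqF.
  rewrite -!(mulrA (((K * M)%:R / kap) ^+ n)) [leRHS]mulrCA.
  rewrite ler_wpM2l ?exprn_ge0 ?divr_ge0 ?(ltW kap0) //.
  apply: le_trans hS; rewrite ler_wpM2r // lerXn2r ?nnegrE ?normc_ge0 //.
  by apply: mulr_ge0; [exact: ltW|apply: divr_ge0].
(* The Fourier normalisations contribute at most [1 / K], which offsets the [K + n] terms of the sum
   up to the factor [n + 1]. *)
have sq : (Num.sqrt (K * M)%:R)^-1 * (Num.sqrt K%:R)^-1 <= K%:R^-1 :> R.
  rewrite -invfM -sqrtrM // lef_pV2 ?posrE ?sqrtr_gt0 ?mulr_gt0 //.
  rewrite -{1}[K%:R]ger0_norm // -sqrtr_sqr ler_wsqrtr // expr2 ler_wpM2r // ler_nat.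
  by rewrite leq_pmulr.
have sq0 : 0 <= (Num.sqrt (K * M)%:R)^-1 * (Num.sqrt K%:R)^-1 :> R.
  by rewrite mulr_ge0 ?invr_ge0 ?sqrtr_ge0.
have Y0 : 0 <= t ^+ n * normc S by rewrite mulr_ge0 // exprn_ge0.
have -> x y u : x * y * u * normc S * t ^+ n = (x * y) * (u * (t ^+ n * normc S)).
  by move=> *; ring.
apply: (@le_trans _ _ (K%:R^-1 * (t ^+ n * normc S))).
  by apply: ler_pM => //; [exact: mulr_ge0|rewrite ler_piMl].
apply: le_trans (ler_wpM2l hK tS) _.
have -> x y u : K%:R^-1 * (x * (y * (u * g))) = (K%:R^-1 * x * y) * (u * g).
  by move=> *; ring.
have -> : n.+1%:R * (C * (1 + M%:R / kap)) ^+ n.+1 * g =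
    (n.+1%:R * (1 + M%:R / kap) ^+ n.+1) * (C ^+ n.+1 * g).
  by rewrite exprMn; move: (C ^+ n.+1) ((1 + _) ^+ n.+1) (n.+1%:R : R) => x y u; ring.
rewrite ler_wpM2r ?mulr_ge0 ?exprn_ge0 //.
apply: ler_pM; [exact: mulr_ge0|exact: exprn_ge0| |].
  rewrite mulrC ler_pdivrMr // -natrM ler_nat mulSn leq_add2l.
  by rewrite leq_pmulr.
have q1 : 1 <= 1 + M%:R / kap by rewrite lerDl.
apply: (@le_trans _ _ ((1 + M%:R / kap) ^+ n)).
  by rewrite lerXn2r ?nnegrE ?addr_ge0 // lerDr.
by rewrite exprS ler_peMl // exprn_ge0 // addr_ge0.
Qed.

End BakerKernel.

(** * Distance to the Cantor set *)

Lemma card_ord_itv (R : realType) n (u v : R) : 0 <= v - u + 1 ->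
  (#|[set l : 'I_n | u <= l%:R <= v]|)%:R <= v - u + 1.
Proof.
move=> uv0; set S := [set _ | _]%SET.
have [S0|/set0Pn[x0 x0S]] := eqVneq S finset.set0; first by rewrite S0 cards0.
pose lo := [arg min_(i < x0 in S) (i : nat)].
pose hi := [arg max_(i > x0 in S) (i : nat)].
have [loS hlo] : lo \in S /\ forall i, i \in S -> (lo <= i)%N.
  by rewrite /lo; case: arg_minnP.
have [hiS hhi] : hi \in S /\ forall i, i \in S -> (i <= hi)%N.
  by rewrite /hi; case: arg_maxnP.
have c1 : (#|S| <= (hi - lo).+1)%N.
  rewrite cardE -(size_map val) -(size_iota lo (hi - lo).+1).
  apply: uniq_leq_size; first by rewrite map_inj_uniq ?enum_uniq //; exact: val_inj.
  move=> x; case/seq.mapP => i; rewrite mem_enum => iS ->.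
  by rewrite mem_iota hlo //= addnS ltnS subnKC ?hhi // hlo.
apply: (@le_trans _ _ ((hi - lo).+1%:R)); first by rewrite ler_nat.
have lohi := hlo _ hiS.
move: loS hiS; rewrite !inE => /andP[l1 _] /andP[_ h2].
by rewrite -natr1 lerD2r natrB //; lra.
Qed.

Section CantorDistance.
Variables (R : realType) (M : nat) (A : {set 'I_M}) (a0 : 'I_M).
Hypotheses (M0 : (0 < M)%N) (a0A : a0 \in A).
Implicit Types (x y : R) (k : nat).

(* [cdist k] is the distance to the [k]-th stage of the Cantor set of numbers
   in [0, 1] all of whose base-[M] digits lie in [A]. *)
Fixpoint cdist k x : R :=
  if k is k'.+1 then
    cdist k' (M%:R * x -
      ([arg min_(a < a0 in A) (cdist k' (M%:R * x - a%:R))]%O : nat)%:R) / M%:R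
  else Num.max 0 (Num.max (- x) (x - 1)).

Let M0' : 0 < M%:R :> R. Proof. by rewrite ltr0n. Qed.

Lemma cdistS k x : exists2 a : 'I_M, a \in A &
  cdist k.+1 x = cdist k (M%:R * x - a%:R) / M%:R /\
  forall b, b \in A -> cdist k.+1 x <= cdist k (M%:R * x - b%:R) / M%:R.
Proof.
rewrite /=; case: arg_minP => // a aA amin; exists a => //; split => // b bA.
by rewrite ler_pM2r ?invr_gt0 // amin.
Qed.

Lemma cdist_ge0 k x : 0 <= cdist k x.
Proof.
elim: k x => [|k IH] x; first by rewrite /= le_max lexx.
by have [a _ [-> _]] := cdistS k x; rewrite divr_ge0 // ltW.
Qed.

(** The stages are nested; the base case is the inclusion of each [[a / M, (a + 1) / M]] in
    [[0, 1]]. *)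
Lemma cdist_leS k x : cdist k x <= cdist k.+1 x.
Proof.
elim: k x => [|k IH] x.
  have [a _ [-> _]] := cdistS 0 x; rewrite ler_pdivlMr //=.
  have aM : a%:R + 1 <= M%:R :> R by rewrite natr1 ler_nat ltn_ord.
  have a1 : 0 <= a%:R :> R by [].
  by rewrite !maxr_pMl ?(ltW M0') // mul0r; rewrite !ge_max !le_max lexx /=;
    apply/andP; split; apply/orP; right; apply/orP; [left|right]; lra.
have [a aA [-> _]] := cdistS k.+1 x; have [_ _ [_ /(_ _ aA)]] := cdistS k x.
by move/le_trans; apply; rewrite ler_pM2r ?invr_gt0.
Qed.

(** The recursion loses one stage, and [cdist_leS] restores it, so that the same distance can serve
    as weight on both sides. *)
Lemma cdist_expand k x (a : 'I_M) : a \in A ->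
  M%:R * cdist k x <= cdist k (M%:R * x - a%:R).
Proof.
move=> aA; rewrite mulrC -ler_pdivlMr //; apply: le_trans (cdist_leS k x) _.
by have [_ _ [_ /(_ _ aA)]] := cdistS k x.
Qed.

Lemma cdist_lipschitz k x y : cdist k x <= cdist k y + `|x - y|.
Proof.
elim: k x y => [|k IH] x y.
  have h1 := ler_norm (x - y); have h2 := ler_norm (- (x - y)); rewrite normrN in h2.
  have h3 := normr_ge0 (x - y).
  rewrite /= !ge_max; set m := Num.max (- y) _.
  have m0 : 0 <= Num.max 0 m by rewrite le_max lexx.
  have m1 : - y <= Num.max 0 m by rewrite !le_max lexx orbT.
  have m2 : y - 1 <= Num.max 0 m by rewrite !le_max lexx !orbT.
  by apply/andP; split; [|apply/andP; split]; lra.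
have [a aA [-> _]] := cdistS k y; have [_ _ [_ /(_ _ aA)]] := cdistS k x.
move/le_trans; apply; rewrite ler_pdivrMr // mulrDl divfK ?gt_eqF //.
apply: le_trans (IH _ (M%:R * y - a%:R)) _; rewrite lerD2l.
have -> : M%:R * x - a%:R - (M%:R * y - a%:R) = (x - y) * M%:R by ring.
by rewrite normrM (gtr0_norm M0').
Qed.

(** Each digit in [A] yields one set of the previous stage, with the progression and [eps] rescaled
    by [M]; a general affine progression makes the induction close. At stage 0 an interval of length
    [1 + 2 * eps] remains. *)
Lemma card_cdist_le k n (al be eps : R) : 0 < al -> 0 <= eps ->
  (#|[set l : 'I_n | cdist k (l%:R * al - be) <= eps]|)%:R <=
    #|A|%:R ^+ k * ((1 + 2 * (M%:R ^+ k * eps)) / (M%:R ^+ k * al) + 1).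
Proof.
elim: k al be eps => [|k IH] al be eps al0 eps0.
  rewrite !expr0 !mul1r.
  have e : (be + 1 + eps) / al - (be - eps) / al + 1 = (1 + 2 * eps) / al + 1.
    by field; rewrite gt_eqF.
  rewrite -e; apply: le_trans (@card_ord_itv R n _ _ _); last first.
    by rewrite e addr_ge0 // divr_ge0 // ?(ltW al0) // addr_ge0 // mulr_ge0.
  rewrite ler_nat; apply/subset_leq_card/fintype.subsetP => l; rewrite !inE /= !ge_max.
  rewrite ler_pdivrMr // ler_pdivlMr // => /and3P[_ h1 h2].
  by apply/andP; split; lra.
pose S a := [set l : 'I_n |
  cdist k (l%:R * (M%:R * al) - (M%:R * be + a%:R)) <= M%:R * eps]%SET.
have sub : [set l : 'I_n | cdist k.+1 (l%:R * al - be) <= eps]%SET \subset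
    (\bigcup_(a in A) S a)%SET.
  apply/fintype.subsetP => l; rewrite inE.
  have [a aA [-> _]] := cdistS k (l%:R * al - be).
  rewrite ler_pdivrMr // => h; apply/bigcupP; exists a => //; rewrite inE mulrC.
  have -> // : M%:R * al * l%:R - (M%:R * be + a%:R) = M%:R * (l%:R * al - be) - a%:R.
    by ring.
  by rewrite [leRHS]mulrC.
apply: (@le_trans _ _ (\sum_(a in A) #|S a|)%:R).
  rewrite ler_nat (leq_trans (subset_leq_card sub)) //.
  elim/big_ind2: _ => [|B1 n1 B2 n2 h1 h2|//]; first by rewrite cards0.
  by rewrite (leq_trans (leq_card_setU _ _)) // leq_add.
rewrite natr_sum.
apply: (@le_trans _ _ (\sum_(a in A) (#|A|%:R ^+ k *
   ((1 + 2 * (M%:R ^+ k * (M%:R * eps))) / (M%:R ^+ k * (M%:R * al)) + 1)))).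
  apply: ler_sum => a _; apply: IH; first by rewrite mulr_gt0.
  by rewrite mulr_ge0 // ltW.
rewrite sumr_const -[leLHS]mulr_natl (exprS #|A|%:R) -[leRHS]mulrA.
by rewrite !(mulrA (M%:R ^+ k)) -!exprSr.
Qed.

End CantorDistance.

(** Telescoping: each term is at most twice an increment of [x / (1 + |x|)], whose values lie in
    [[-1, 1]]. *)
Lemma sum_inv_sq_dist (R : realType) n (c : nat) :
  \sum_(j < n) ((1 + `|j%:R - c%:R|) ^+ 2)^-1 <= 4 :> R.
Proof.
pose F (x : R) : R := x / (1 + `|x|).
have d0 (x : R) : 0 < 1 + `|x| by rewrite ltr_wpDr.
have F1 x : `|F x| <= 1.
  by rewrite /F normrM normfV (gtr0_norm (d0 x)) ler_pdivrMr // mul1r lerDr.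
have step (j : nat) : ((1 + `|j%:R - c%:R|) ^+ 2)^-1 <=
    2 * (F (j.+1%:R - c%:R) - F (j%:R - c%:R)).
  have [cj|jc] := leqP c j.
    have -> : j.+1%:R - c%:R = (j - c)%:R + 1 :> R by rewrite natrB // -natr1; ring.
    rewrite -natrB //; set x : R := (j - c)%:R.
    have x0 : 0 <= x by [].
    rewrite /F !ger0_norm ?addr_ge0 //.
    have -> : 2 * ((x + 1) / (1 + (x + 1)) - x / (1 + x)) = 2 / ((1 + x) * (2 + x)).
      by field; rewrite !gt_eqF //; lra.
    rewrite -[leLHS]mul1r ler_pdivrMr ?mulr_gt0 //; try lra.
    rewrite mulrAC ler_pdivlMr; last by apply: mulr_gt0; lra.
    by nra.
  have -> : j%:R - c%:R = - (c - j.+1)%:R - 1 :> R by rewrite natrB // -natr1; ring.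
  have -> : j.+1%:R - c%:R = - (c - j.+1)%:R :> R by rewrite natrB //; ring.
  set x : R := (c - j.+1)%:R.
  have x0 : 0 <= x by [].
  rewrite /F -opprD !normrN !ger0_norm ?addr_ge0 //.
  have -> : 2 * (- x / (1 + x) - - (x + 1) / (1 + (x + 1))) = 2 / ((1 + x) * (2 + x)).
    by field; rewrite !gt_eqF //; lra.
  rewrite -[leLHS]mul1r ler_pdivrMr; last by rewrite exprn_gt0 //; lra.
  rewrite mulrAC ler_pdivlMr; last by apply: mulr_gt0; lra.
  by nra.
apply: (@le_trans _ _ (\sum_(j < n) 2 * (F (j.+1%:R - c%:R) - F (j%:R - c%:R)))).
  by apply: ler_sum => j _; exact: step.
rewrite -mulr_sumr -(big_mkord xpredT (fun j => F (j.+1%:R - c%:R) - F (j%:R - c%:R))).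
rewrite (telescope_sumr (fun j => F (j%:R - c%:R))) //.
have := F1 (n%:R - c%:R); have := F1 (0%:R - c%:R).
by rewrite !ler_norml => /andP[? ?] /andP[? ?]; lra.
Qed.

(** * Weighted columns and the eigenvalue count *)

Lemma powR_exprn (R : realType) (x s : R) n : 0 <= x ->
  powR (x ^+ n) s = powR x s ^+ n.
Proof.
move=> x0; elim: n => [|n IH]; first by rewrite !expr0 powR1.
by rewrite !exprS powRM ?exprn_ge0 // IH.
Qed.

Lemma powR_ge1 (R : realType) (x s : R) : 1 <= x -> 0 <= s -> 1 <= powR x s.
Proof. by move=> x1 s0; rewrite -(powRr0 x) ler_powR. Qed.

Lemma fact_leq_expn n : (n`! <= n ^ n)%N.
Proof.
elim: n => [//|n IH]; rewrite factS expnS leq_mul2l /=.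
by case: n IH => // n IH; rewrite (leq_trans IH) // leq_exp2r.
Qed.

(** * Gevrey decay against a polynomial weight *)

Section WeightedDecay.
Variables (R : realType) (s C1 : R) (p : nat).
Hypotheses (s0 : 0 <= s) (C1ge1 : 1 <= C1).

Local Notation E := (powR (2 : R) s).
(** The constants are those that enter [decay_times_weight] to the power [p]: 8 is 4 from
    [1 + t / W <= 4 * t / W] times 2 from [p + 3 <= 2 ^ (p + 2)], and [powR 2 s ^+ 2] absorbs the
    two surplus powers of [powR p.+2 s]. *)
Definition wscale : R := 8 * C1 * powR 2 s ^+ 2 * powR (p.+2%:R) s.
Local Notation W := wscale.

Lemma wscale_ge8 : 8 <= W.
Proof.
have E1 : 1 <= powR (2 : R) s by apply: powR_ge1 => //; lra.
have P1 : 1 <= powR (p.+2%:R : R) s by apply: powR_ge1 => //; rewrite ler1n.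
have E2 : 1 <= powR (2 : R) s ^+ 2 by rewrite exprn_ege1.
rewrite /wscale; move: E2 P1; move: (_ ^+ 2) (powR p.+2%:R s) => x y x1 y1.
have xy : 1 <= x * y by rewrite -[1]mulr1 ler_pM.
rewrite -!mulrA; have : 1 <= C1 * (x * y) by rewrite -[1]mulr1 ler_pM.
by lra.
Qed.

(* For [t <= W / 3] the decay of order 2 suffices; beyond, the decay of order
   [p + 2] absorbs the weight, because [W] is a large multiple of [p ^ s]. *)
Lemma decay_times_weight (b t : R) : 0 <= b -> 0 <= t ->
  (forall n, b * t ^+ n <= n.+1%:R * C1 ^+ n.+1 * powR (n`!%:R) s) ->
  b * (1 + t / W) ^+ p * (1 + t) ^+ 2 <= 16 * C1 ^+ 3 * E ^+ 4 * (4 / 3) ^+ p.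
Proof.
move=> b0 t0 hb; have W8 := wscale_ge8; have W0 : 0 < W by lra.
have E1 : 1 <= E by apply: powR_ge1 => //; lra.
have C0 : 0 <= C1 by exact: le_trans C1ge1.
have E0 : 0 <= E by lra.
have q1 : 1 <= (4 / 3 : R) ^+ p by rewrite exprn_ege1 //; lra.
have [tW|Wt] := leP (3 * t) W.
  have h1 : (1 + t / W) ^+ p <= (4 / 3) ^+ p.
    rewrite lerXn2r ?nnegrE ?addr_ge0 ?divr_ge0 ?(ltW W0) //.
    suff : t / W <= 1 / 3 by lra.
    by rewrite ler_pdivrMr //; lra.
  have h0 := hb 0; have h2 := hb 2.
  rewrite expr0 mulr1 expr1 fact0 powR1 mulr1 mul1r in h0.
  have e2 : powR (2`!%:R) s = E by [].
  rewrite e2 in h2.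
  have C13 : C1 <= C1 ^+ 3 by rewrite -[leLHS]expr1 ler_weXn2l.
  have E4 : E <= E ^+ 4 by rewrite -[leLHS]expr1 ler_weXn2l.
  have CE : C1 ^+ 3 <= C1 ^+ 3 * E by rewrite ler_peMr // exprn_ge0.
  have CE4 : C1 ^+ 3 * E <= C1 ^+ 3 * E ^+ 4 by rewrite ler_wpM2l // exprn_ge0.
  have hbt : b * (1 + t) ^+ 2 <= 16 * C1 ^+ 3 * E ^+ 4.
    have : b * (1 + t) ^+ 2 <= 2 * b + 2 * (b * t ^+ 2).
      have : 0 <= b * (1 - t) ^+ 2 by rewrite mulr_ge0 // sqr_ge0.
      by nra.
    by move/le_trans; apply; lra.
  rewrite mulrAC ler_pM ?mulr_ge0 ?exprn_ge0 ?addr_ge0 ?divr_ge0 ?(ltW W0) //.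
have t1 : 1 <= t by lra.
pose P := powR (p.+2%:R : R) s.
have P0 : 0 < P by rewrite powR_gt0 // ltr0n.
(* From [p + 2 <= 2 ^ (p + 2)]. *)
have PE : P <= E ^+ p.+2.
  rewrite /P -powR_exprn //; apply: ge0_ler_powR; rewrite ?nnegrE ?exprn_ge0 //.
  by rewrite -natrX ler_nat ltnW // ltn_expl.
have fP : powR (p.+2`!%:R) s <= P ^+ p.+2.
  rewrite /P -powR_exprn //; apply: ge0_ler_powR; rewrite ?nnegrE ?exprn_ge0 //.
  by rewrite -natrX ler_nat fact_leq_expn.
have h1 : (1 + t / W) ^+ p <= (4 * t) ^+ p / W ^+ p.
  rewrite -expr_div_n lerXn2r ?nnegrE ?addr_ge0 ?divr_ge0 ?mulr_ge0 ?(ltW W0) //.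
  by rewrite ler_pdivlMr // mulrDl divfK ?gt_eqF //; lra.
have h2 : (1 + t) ^+ 2 <= 4 * t ^+ 2 by nra.
have h3 : b * (1 + t / W) ^+ p * (1 + t) ^+ 2 <=
    4 * 4 ^+ p / W ^+ p * (b * t ^+ p.+2).
  have -> : 4 * 4 ^+ p / W ^+ p * (b * t ^+ p.+2) =
     b * ((4 * t) ^+ p / W ^+ p) * (4 * t ^+ 2).
    rewrite -(addn2 p) exprD (exprMn p 4 t).
    by move: (4 ^+ p) (t ^+ p) (W ^- p) => x y z; ring.
  rewrite ler_pM ?mulr_ge0 ?exprn_ge0 ?addr_ge0 ?divr_ge0 ?(ltW W0) //.
  by rewrite ler_wpM2l.
apply: le_trans h3 _.
have h4 : b * t ^+ p.+2 <= (4 * 2 ^+ p) * C1 ^+ p.+3 * P ^+ p.+2.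
  apply: le_trans (hb _) _.
  apply: ler_pM; [by rewrite mulr_ge0 ?exprn_ge0|exact: powR_ge0| |exact: fP].
  rewrite ler_wpM2r ?exprn_ge0 //.
  have -> : 4 * 2 ^+ p = (2 ^ p.+2)%:R :> R.
    by rewrite natrX !exprS mulrA; congr (_ * _); ring.
  by rewrite ler_nat ltn_expl.
have WE : W ^+ p = (8 * C1 * E ^+ 2) ^+ p * P ^+ p by rewrite -exprMn.
have k0 : 0 <= 4 * 4 ^+ p / W ^+ p by rewrite divr_ge0 ?mulr_ge0 ?exprn_ge0 ?(ltW W0).
apply: le_trans (ler_wpM2l k0 h4) _.
have -> : 4 * 4 ^+ p / W ^+ p * (4 * 2 ^+ p * C1 ^+ p.+3 * P ^+ p.+2) =
   16 * C1 ^+ 3 * (P ^+ 2 / (E ^+ 2) ^+ p).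
  rewrite WE !exprMn !(exprS C1) !(exprS P).
  have -> : 8 ^+ p = 4 ^+ p * 2 ^+ p :> R by rewrite -exprMn; congr (_ ^+ p); ring.
  have nE : E != 0 by rewrite gt_eqF // (lt_le_trans ltr01).
  have nC : C1 != 0 by rewrite gt_eqF // (lt_le_trans ltr01).
  have nP : P != 0 by rewrite gt_eqF.
  have n4 : (4 : R) != 0 by [].
  have n2 : (2 : R) != 0 by [].
  by field; rewrite ?mulf_neq0 ?expf_neq0.
have PE2 : P ^+ 2 / (E ^+ 2) ^+ p <= E ^+ 4.
  have E0' : 0 < E by exact: lt_le_trans E1.
  rewrite ler_pdivrMr ?exprn_gt0 // -exprM -exprD.
  have -> : (4 + 2 * p = p.+2 * 2)%N by rewrite (mulnC 2) 2!mulSn.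
  by rewrite exprM lerXn2r ?nnegrE ?exprn_ge0 ?(ltW P0).
apply: (@le_trans _ _ (16 * C1 ^+ 3 * E ^+ 4)).
  by rewrite ler_wpM2l ?mulr_ge0 ?exprn_ge0.
by rewrite ler_peMr // !mulr_ge0 ?exprn_ge0.
Qed.

(** With [t] the distance from [j] to [c], the ratio [(W + D) / (W + d j)] is at most
    [rho * (1 + t / W)]. The power of [rho] factors out, [decay_times_weight] treats the rest, and
    64 is 16 times the sum of the inverse squares. *)
Lemma weighted_column_bound n (b d : 'I_n -> R) (D mu : R) (c : nat) :
  1 <= mu -> 0 <= D -> (forall j, 0 <= b j) -> (forall j, 0 <= d j) ->
  (forall j, mu * D <= d j + `|j%:R - c%:R|) ->
  (forall j k, b j * `|j%:R - c%:R| ^+ k <=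
     k.+1%:R * C1 ^+ k.+1 * powR (k`!%:R) s) ->
  \sum_j b j * (W + d j) ^- p / (W + D) ^- p <=
    64 * C1 ^+ 3 * E ^+ 4 * (4 / 3 * ((W + D) / (W + mu * D))) ^+ p.
Proof.
move=> mu1 D0 b0 d0 hd hb; have W8 := wscale_ge8; have W0 : 0 < W by lra.
have mD : 0 <= mu * D by rewrite mulr_ge0 //; lra.
set rho := (W + D) / (W + mu * D).
have rho0 : 0 <= rho by rewrite divr_ge0; lra.
pose Q := 16 * C1 ^+ 3 * E ^+ 4 * (4 / 3) ^+ p.
have term j : b j * (W + d j) ^- p / (W + D) ^- p <=
    Q * rho ^+ p * ((1 + `|j%:R - c%:R|) ^+ 2)^-1.
  set t : R := `|j%:R - c%:R|; have t0 : 0 <= t by exact: normr_ge0.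
  have dj := d0 j.
  rewrite ler_pdivlMr; last by rewrite exprn_gt0 //; lra.
  have -> : b j * (W + d j) ^- p / (W + D) ^- p = b j * ((W + D) / (W + d j)) ^+ p.
    by rewrite invrK expr_div_n -mulrA [_ ^- p * _]mulrC.
  have r : (W + D) / (W + d j) <= rho * (1 + t / W).
    have Wd : 0 < W + mu * D by lra.
    have e : W + D = rho * (W + mu * D) by rewrite /rho divfK // gt_eqF.
    rewrite ler_pdivrMr; last lra.
    rewrite [leLHS]e -[leRHS]mulrA ler_wpM2l //.
    have := hd j; rewrite -/t => hdj.
    have dt : 0 <= d j * (t / W) by rewrite mulr_ge0 // divr_ge0 // ltW.
    have Wt : t / W * W = t by rewrite divfK // gt_eqF.
    by rewrite mulrDl mul1r mulrDr Wt; lra.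
  apply: (@le_trans _ _ (b j * (rho * (1 + t / W)) ^+ p * (1 + t) ^+ 2)).
    rewrite ler_wpM2r ?sqr_ge0 // ler_wpM2l // lerXn2r ?nnegrE //.
      by rewrite divr_ge0 //; lra.
    by rewrite mulr_ge0 // addr_ge0 // divr_ge0 // ltW.
  have -> : b j * (rho * (1 + t / W)) ^+ p * (1 + t) ^+ 2 =
      b j * (1 + t / W) ^+ p * (1 + t) ^+ 2 * rho ^+ p.
    by rewrite (exprMn p rho); move: (rho ^+ p) (_ ^+ p) => x y; ring.
  by rewrite ler_wpM2r ?exprn_ge0 // decay_times_weight.
apply: le_trans (ler_sum _ (fun j _ => term j)) _; rewrite -mulr_sumr.
apply: le_trans (ler_wpM2l _ (sum_inv_sq_dist R n c)) _.
  have C0 : 0 <= C1 by exact: le_trans C1ge1.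
  by rewrite /Q !mulr_ge0 ?exprn_ge0 ?powR_ge0.
rewrite /Q (exprMn p (4 / 3) rho) le_eqVlt; apply/orP; left; apply/eqP.
by move: (_ ^+ p) (rho ^+ p) (E ^+ 4) (C1 ^+ 3) => x y u v; ring.
Qed.

End WeightedDecay.

(** * From column sums to the eigenvalue count *)

Lemma char_poly_eigenvalues (R : realType) n (B : 'M[R[i]]_n) :
  char_poly B = \prod_(z <- eigenvalues B) ('X - z%:P).
Proof.
rewrite /eigenvalues; case: closed_field_poly_normal => r /= {1}->.
by rewrite (eqP (char_poly_monic B)) scale1r.
Qed.

(** Only the eigenvalues of modulus at least [t] are prescribed in [invariant_rows], so the
    determinant of [T] dominates the power of [t]. *)
Lemma eig_count_pow_le (R : realType) n (B : 'M[R[i]]_n) (t : R) (w : 'I_n -> R) :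
  0 <= t -> (forall l, 0 < w l) ->
  exists2 J : 'I_(eig_count B t) -> 'I_n, injective J &
    t ^+ eig_count B t <= \prod_i \sum_l normc (B l (J i)) * w l / w (J i).
Proof.
move=> t0 w0; pose P (z : R[i]) := t%:C <= `|z|.
have hc : char_poly B = \prod_(z <- seq.filter P (eigenvalues B)) ('X - z%:P) *
    \prod_(z <- eigenvalues B | ~~ P z) ('X - z%:P).
  by rewrite char_poly_eigenvalues big_filter (bigID P) /=.
have [V [T [fV hV hT]]] := invariant_rows hc.
have w0' l : 0 < (w l)%:C by rewrite ltcR.
have [J Jinj hJ] := invariant_det_bound w0' fV hV.
have e : size (seq.filter P (eigenvalues B)) = eig_count B t by rewrite size_filter.
rewrite -e; exists J => //; rewrite -lecR; apply: le_trans (le_trans hJ _).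
  rewrite hT rmorphXn /= normr_prod.
  elim: (eigenvalues B) => [|z r IH] /=; first by rewrite big_nil expr0.
  have t0c : 0 <= t%:C by rewrite ler0c.
  by case: ifP => // Pz; rewrite big_cons exprS ler_pM ?exprn_ge0.
rewrite rmorph_prod le_eqVlt; apply/orP; left; apply/eqP.
apply: eq_bigr => i _; rewrite rmorph_sum; apply: eq_bigr => l _.
by rewrite normr_normc rmorphM fmorphV rmorphM.
Qed.

(** If [a] of the [m] selected columns lie in [X], then [t ^ m <= (Q * q ^ 3) ^ a * (Q / q) ^ (m -
    a)]. Squaring and using [(Q / t) ^ 2 <= q] gives [2 * (m - a) <= m + 6 * a], hence the factor
    8. *)
Lemma eig_count_le_card (R : realType) n (B : 'M[R[i]]_n) (t Q q : R)
    (w : 'I_n -> R) (X : {set 'I_n}) :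
  0 < t -> (forall l, 0 < w l) -> 0 < Q -> 1 < q -> (Q / t) ^+ 2 <= q ->
  (forall l, \sum_j normc (B j l) * w j / w l <= Q * q ^+ 3) ->
  (forall l, l \notin X -> \sum_j normc (B j l) * w j / w l <= Q / q) ->
  (eig_count B t <= 8 * #|X|)%N.
Proof.
move=> t0 w0 Q0 q1 hq h1 h2; have q0 : 0 < q by exact: lt_trans q1.
have [J Jinj] := eig_count_pow_le B (ltW t0) w0; set m := eig_count B t => hJ.
pose a := #|[set i : 'I_m | J i \in X]%SET|.
have aX : (a <= #|X|)%N.
  rewrite /a -(card_imset _ Jinj); apply/subset_leq_card/fintype.subsetP => l.
  by case/imsetP=> i; rewrite inE => iX ->.
have am : (a <= m)%N by rewrite (leq_trans (max_card _)) // card_ord.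
suff : (m <= 8 * a)%N by move/leq_trans; apply; rewrite leq_mul2l aX orbT.
have tm : t ^+ m <= (Q * q ^+ 3) ^+ a * (Q / q) ^+ (m - a).
  apply: le_trans hJ _.
  apply: (@le_trans _ _ (\prod_i (if J i \in X then Q * q ^+ 3 else Q / q))).
    apply: ler_prod => i _; apply/andP; split.
      apply: sumr_ge0 => l _; rewrite divr_ge0 ?mulr_ge0 ?normc_ge0 //; exact: ltW.
    by case: ifP => [_|/negbT iX]; [exact: h1|exact: h2].
  rewrite big_if /= !prodr_const.
  have -> : #|[pred i | J i \in X]| = a by apply: eq_card => i; rewrite !inE.
  have -> // : #|[pred i | J i \notin X]| = (m - a)%N.
  have := cardsC [set i : 'I_m | J i \in X]%SET; rewrite card_ord -/a => <-.
  by rewrite addKn; apply: eq_card => i; rewrite !inE.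
have tq : (t ^+ m) ^+ 2 * q ^+ (2 * (m - a)) <= (Q ^+ m) ^+ 2 * q ^+ (6 * a).
  have -> : (Q ^+ m) ^+ 2 * q ^+ (6 * a) =
      ((Q * q ^+ 3) ^+ a * (Q / q) ^+ (m - a)) ^+ 2 * q ^+ (2 * (m - a)).
    have e2 : q ^+ (2 * (m - a)) = (q ^+ (m - a)) ^+ 2 by rewrite mulnC exprM.
    have e6 : q ^+ (6 * a) = (q ^+ a) ^+ 6 by rewrite mulnC exprM.
    have e3 : (q ^+ 3) ^+ a = (q ^+ a) ^+ 3 by rewrite -!exprM mulnC.
    have em : Q ^+ m = Q ^+ a * Q ^+ (m - a) by rewrite -exprD subnKC.
    have nz : q ^+ (m - a) != 0 by rewrite expf_neq0 // gt_eqF.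
    rewrite e2 e6 em (exprMn a) e3 expr_div_n; move: nz.
    by move: (q ^+ (m - a)) (q ^+ a) (Q ^+ a) (Q ^+ (m - a)) => x y u v nz; field.
  rewrite ler_wpM2r ?exprn_ge0 ?(ltW q0) // lerXn2r ?nnegrE //.
    by rewrite exprn_ge0 // ltW.
  by apply: le_trans tm; rewrite exprn_ge0 // ltW.
have Qt : (Q ^+ m) ^+ 2 <= q ^+ m * (t ^+ m) ^+ 2.
  rewrite -!exprM !(mulnC m) !exprM -exprMn lerXn2r ?nnegrE ?exprn_ge0 ?(ltW Q0) //.
    by rewrite mulr_ge0 ?exprn_ge0 ?ltW.
  by rewrite -ler_pdivrMr ?exprn_gt0 // -expr_div_n.
have : q ^+ (2 * (m - a)) <= q ^+ (m + 6 * a).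
  have tt : 0 < (t ^+ m) ^+ 2 by rewrite !exprn_gt0.
  rewrite -(ler_pM2l tt); apply: le_trans tq _.
  rewrite exprD mulrA [in leRHS](mulrC (_ ^+ 2)).
  by rewrite ler_wpM2r ?exprn_ge0 ?(ltW q0).
by rewrite ler_eXn2l //; lia.
Qed.

(** * Positions near the Cantor set *)

Lemma exists_log_floor (R : realType) (M : nat) (y : R) : (2 <= M)%N -> 1 <= y ->
  exists k, M%:R ^+ k <= y < M%:R ^+ k.+1.
Proof.
move=> M2 y1.
have ex : exists n, y < M%:R ^+ n.
  exists (Num.truncn y).+1; apply: lt_le_trans (truncnS_gt y) _.
  by rewrite -natrX ler_nat ltnW // ltn_expl.
case: (ex_minnP ex) => -[|k] hk kmin; first by move: hk; rewrite expr0 ltNge y1.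
exists k; rewrite hk andbT leNgt; apply/negP => /kmin; by rewrite ltnn.
Qed.

(** For [M ^ k <= N / W < M ^ (k + 1)], stage [k] has at most [(N / W) ^ delta] intervals, each with
    at most [N / M ^ k + 2 * W + 1 <= (M + 3) * W] positions nearby. *)
Lemma card_near_cantor (R : realType) (M : nat) (A : {set 'I_M}) (a0 : 'I_M)
    (N : nat) (W : R) : (2 <= M)%N -> a0 \in A -> (0 < N)%N -> 1 <= W ->
  let delta := ln (#|A|%:R : R) / ln (M%:R : R) in
  exists k, (#|[set l : 'I_N | N%:R * cdist A a0 k (l%:R / N%:R) <= W]|)%:R <=
    (M%:R + 3) * powR (N%:R) delta * powR W (1 - delta).
Proof.
move=> M2 a0A N0 W1 delta.
have M0 : (0 < M)%N by exact: ltnW.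
have M0' : 0 < M%:R :> R by rewrite ltr0n.
have N0' : 0 < N%:R :> R by rewrite ltr0n.
have W0 : 0 < W by exact: lt_le_trans W1.
have A1 : (1 <= #|A|)%N by rewrite card_gt0; apply/set0Pn; exists a0.
have A0' : 0 < #|A|%:R :> R by rewrite ltr0n.
have AM : (#|A| <= M)%N by rewrite (leq_trans (max_card _)) // card_ord.
have lnM : 0 < ln (M%:R : R) by rewrite ln_gt0 // ltr1n.
have de0 : 0 <= delta by rewrite divr_ge0 ?ln_ge0 ?ler1n // ltW.
have de1 : delta <= 1 by rewrite ler_pdivrMr // mul1r ler_ln ?posrE // ler_nat.
have MA : powR (M%:R : R) delta = #|A|%:R.
  by rewrite /powR gt_eqF // divfK ?gt_eqF // lnK ?posrE.
have P0 : 0 <= powR (N%:R : R) delta * powR W (1 - delta).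
  by rewrite mulr_ge0 ?powR_ge0.
(* When [N < W] the trivial count [N] suffices. *)
have [NW|WN] := ltP N%:R W.
  exists 0; apply: (@le_trans _ _ N%:R).
    by rewrite ler_nat (leq_trans (max_card _)) // card_ord.
  apply: (@le_trans _ _ (powR N%:R delta * powR W (1 - delta))).
    have e : N%:R = powR (N%:R : R) delta * powR N%:R (1 - delta).
      rewrite -powRD; last by rewrite (gt_eqF N0') implybT.
      by rewrite addrC subrK powRr1 // ltW.
    rewrite [leLHS]e ler_wpM2l ?powR_ge0 //.
    by apply: ge0_ler_powR; rewrite ?nnegrE ?subr_ge0 // ltW.
  by rewrite -mulrA ler_peMl //; lra.
have y1 : 1 <= N%:R / W by rewrite ler_pdivlMr // mul1r.
have [k /andP[k1 k2]] := exists_log_floor M2 y1.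
exists k.
have Mk0 : 0 < M%:R ^+ k :> R by rewrite exprn_gt0.
have -> : [set l : 'I_N | N%:R * cdist A a0 k (l%:R / N%:R) <= W]%SET =
    [set l : 'I_N | cdist A a0 k (l%:R * N%:R^-1 - 0) <= W / N%:R]%SET.
  by apply/setP => l; rewrite !inE subr0 ler_pdivlMr // mulrC.
apply: le_trans (card_cdist_le M0 a0A k N 0 _ _) _; first by rewrite invr_gt0.
  by rewrite divr_ge0 // ltW.
have -> : (1 + 2 * (M%:R ^+ k * (W / N%:R))) / (M%:R ^+ k * N%:R^-1) + 1 =
    N%:R / M%:R ^+ k + 2 * W + 1 :> R by field; rewrite !gt_eqF.
have NM : N%:R / M%:R ^+ k <= M%:R * W.
  by rewrite ler_pdivrMr // mulrAC -exprS -ler_pdivrMr // ltW.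
have Ak : #|A|%:R ^+ k <= powR N%:R delta * powR W (- delta).
  rewrite -MA -powR_exprn ?(ltW M0') // powRN.
  apply: (@le_trans _ _ (powR (N%:R / W) delta)).
    apply: ge0_ler_powR => //; rewrite nnegrE; first exact: ltW.
    by rewrite (le_trans _ y1).
  by rewrite powRM ?invr_ge0 ?(ltW W0) // -powR_inv1 ?(ltW W0) // -powRrM mulN1r powRN.
apply: (@le_trans _ _ (powR N%:R delta * powR W (- delta) * ((M%:R + 3) * W))).
  have NM0 : 0 <= N%:R / M%:R ^+ k :> R by apply: divr_ge0 => //; exact: ltW.
  by apply: ler_pM => //; lra.
have -> : powR W (1 - delta) = W * powR W (- delta).
  by rewrite powRD ?powRr1 ?(ltW W0) // (gt_eqF W0) implybT.
by rewrite le_eqVlt; apply/orP; left; apply/eqP; ring.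
Qed.

(** * The eigenvalue count of the baker's map *)

Section BakerCount.
Variables (R : realType) (M : nat) (s c C : R) (chi : R -> R).
Hypotheses (M2 : (2 <= M)%N) (s0 : 0 <= s) (hc : 0 < c <= 1 / 2).
Hypothesis supp : forall x, chi x != 0 -> c <= x <= 1 - c.
Hypotheses (C1 : 1 <= C) (smo : smooth chi) (chi1 : forall x, `|chi x| <= 1).
Hypothesis der : forall k x, `|derive1n k chi x| <= C ^+ k.+1 * powR (k`!%:R) s.

Definition kernel_cst : R := C * (1 + M%:R / (2 * pi * cos (pi * (1 - c) / 2) ^+ 2)).
Definition column_cst : R := 64 * kernel_cst ^+ 3 * powR 2 s ^+ 4.

Lemma kernel_cst_ge1 : 1 <= kernel_cst.
Proof.
rewrite -[1]mulr1 ler_pM // lerDl divr_ge0 // mulr_ge0 ?sqr_ge0 //.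
by rewrite mulr_ge0 ?pi_ge0.
Qed.

(* Far from the Cantor set the expansion gains a factor [2 / 3] against the loss
   [4 / 3] of [decay_times_weight], which leaves [8 / 9]. *)
Lemma baker_eig_count_le (A : {set 'I_M}) (a0 : 'I_M) K p k (t : R) :
  a0 \in A -> (0 < K)%N -> (0 < p)%N -> 0 < t ->
  (column_cst / t) ^+ 2 <= (9 / 8) ^+ p ->
  (eig_count (baker K A chi) t <= 8 *
    #|[set l : 'I_(K * M) | ((K * M)%N%:R * cdist A a0 k (l%:R / (K * M)%N%:R)
        <= wscale s kernel_cst p)%R]%SET|)%N.
Proof.
move=> a0A K0 p0 t0 hq.
have M0 : (0 < M)%N by exact: ltnW.
have K0' : 0 < K%:R :> R by rewrite ltr0n.
have M0' : 0 < M%:R :> R by rewrite ltr0n.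
have N0' : 0 < (K * M)%:R :> R by rewrite ltr0n muln_gt0 K0.
have k1 := kernel_cst_ge1; set W := wscale s kernel_cst p.
have W8 : 8 <= W by exact: wscale_ge8.
pose d (x : R) := (K * M)%:R * cdist A a0 k (x / (K * M)%:R).
have d0 x : 0 <= d x by rewrite mulr_ge0 ?cdist_ge0.
pose w (l : 'I_(K * M)) := (W + d l%:R) ^- p.
have w0 l : 0 < w l by rewrite invr_gt0 exprn_gt0 // ltr_wpDr //; lra.
have Q0 : 0 < column_cst.
  have k0 : 0 < kernel_cst by exact: lt_le_trans k1.
  by rewrite mulr_gt0 ?exprn_gt0 ?powR_gt0 // mulr_gt0 ?exprn_gt0.
have q1 : 1 < (9 / 8 : R) ^+ p by rewrite exprn_egt1 // -?lt0n //; lra.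
have col l : \sum_j normc (baker K A chi j l) * w j / w l <=
    column_cst * (4 / 3 * ((W + d l%:R) / (W + M%:R * d l%:R))) ^+ p.
  have aM : (l %/ K < M)%N by rewrite ltn_divLR // (mulnC M).
  pose a := Ordinal aM; have la : (l %/ K)%N = a by [].
  have dec j n := baker_decay K0 A j n M0 la hc supp C1 smo chi1 der.
  (* A column whose digit is not in [A] is zero. *)
  have [aA|aA] := boolP (a \in A); last first.
    rewrite big1 => [|j _].
      rewrite mulr_ge0 ?(ltW Q0) // exprn_ge0 // mulr_ge0 // divr_ge0 //.
        by have := d0 l%:R; lra.
      by have : 0 <= M%:R * d l%:R; [rewrite mulr_ge0|lra].
    have := dec j 0%N; rewrite (negbTE aA) mul0r expr0 mulr1 => b0.
    have -> : normc (baker K A chi j l) = 0.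
      by apply/eqP; rewrite eq_le b0 normc_ge0.
    by rewrite !mul0r.
  apply: (@weighted_column_bound R s kernel_cst p s0 k1 _ _ (fun j => d j%:R)
     _ _ (l %% K * M)%N) => //.
  - by rewrite ler1n.
  - by move=> j; exact: normc_ge0.
  - move=> j; rewrite /d mulrCA.
    have E2 := cdist_lipschitz (R := R) M0 a0A k ((l %% K * M)%:R / (K * M)%:R)
      (j%:R / (K * M)%:R).
    have e : M%:R * (l%:R / (K * M)%:R) - a%:R = (l %% K * M)%:R / (K * M)%:R :> R.
      rewrite [in LHS](divn_eq l K) natrD !natrM /=; field.
      by rewrite !gt_eqF.
    have E1 : M%:R * cdist A a0 k (l%:R / (K * M)%:R) <=
        cdist A a0 k ((l %% K * M)%:R / (K * M)%:R) :> R.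
      by rewrite -e; exact: cdist_expand.
    have := le_trans E1 E2.
    rewrite -(ler_pM2l N0') => /le_trans; apply.
    rewrite mulrDr lerD2l -mulrBl normrM normfV (gtr0_norm N0') distrC.
    by rewrite mulrC divfK // gt_eqF.
  - by move=> j n; have := dec j n; rewrite aA mul1r natrM.
have DM l : d l%:R <= M%:R * d l%:R by rewrite ler_peMl // ler1n.
have rho0 l : 0 <= 4 / 3 * ((W + d l%:R) / (W + M%:R * d l%:R)).
  have D0 := d0 l%:R; have DMl := DM l.
  by apply: mulr_ge0; [lra|apply: divr_ge0; lra].
(* Off the set, [W < D] and [M >= 2] give [(W + D) / (W + M * D) <= 2 / 3]. *)
apply: (eig_count_le_card t0 w0 Q0 q1 hq) => l; last first.
  rewrite inE -ltNge => Wd; have {}Wd : W < d l%:R by exact: Wd.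
  apply: le_trans (col l) _; rewrite ler_wpM2l ?(ltW Q0) // -exprVn.
  have D2 : 2 * d l%:R <= M%:R * d l%:R by rewrite ler_wpM2r // ler_nat.
  have D0 := d0 l%:R.
  rewrite lerXn2r ?nnegrE ?rho0 ?invr_ge0 //; try lra.
  have -> : (9 / 8)^-1 = 4 / 3 * (2 / 3) :> R by field.
  rewrite ler_pM2l; last lra.
  by rewrite ler_pdivrMr; lra.
apply: le_trans (col l) _; rewrite ler_wpM2l ?(ltW Q0) // -exprM (mulnC p) exprM.
have D0 := d0 l%:R; have DMl := DM l.
rewrite lerXn2r ?nnegrE ?rho0 ?exprn_ge0 //; try lra.
(* On the set only the loss [4 / 3] remains, and it is below [(9 / 8) ^ 3]. *)
apply: (@le_trans _ _ (4 / 3)).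
  by rewrite ler_piMr // ler_pdivrMr; lra.
by lra.
Qed.

End BakerCount.

Theorem theorem2 (R : realType) (M : nat) (s : R) (chi : R -> R) :
  (2 <= M)%N -> 1 < s -> gevrey_c01 s chi ->
  (forall x : R, 0 <= chi x <= 1) ->
  exists C : R, forall A : {set 'I_M}, A != finset.set0 ->
    let delta := ln (#|A|%:R : R) / ln (M%:R : R) in
    exists N0 : nat, forall (nu : R) (K : nat), 1 <= nu -> (N0 <= K * M)%N ->
      ((counting_fn K A chi nu)%:R : R)
        <= C * powR ((K * M)%:R) delta * powR nu ((1 - delta) * s).
Proof.
move=> M2 s1 gchi chi01.
have s0 : 0 <= s by lra.
have [c hc supp] := gevrey_support gchi.
have [C C1 der] := gevrey_derive_bound gchi.
have smo : smooth chi by case: gchi.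
have chi1 x : `|chi x| <= 1 by case/andP: (chi01 x) => h0 h1; rewrite ger0_norm.
have M1' : 1 <= M%:R :> R by rewrite ler1n ltnW.
have M0' : 0 < M%:R :> R by rewrite ltr0n ltnW.
pose ck := kernel_cst M c C; have k1 : 1 <= ck by exact: kernel_cst_ge1.
pose Q := column_cst M s c C.
have E1 : 1 <= powR (2 : R) s by apply: powR_ge1 => //; lra.
have Q1 : 1 <= Q.
  have a3 : 1 <= ck ^+ 3 by rewrite exprn_ege1.
  have a4 : 1 <= powR (2 : R) s ^+ 4 by rewrite exprn_ege1.
  rewrite /Q /column_cst -/ck -mulrA.
  have : 1 <= ck ^+ 3 * powR 2 s ^+ 4 by rewrite mulr_ege1.
  by lra.
have QM0 : 0 <= Q * M%:R by apply: mulr_ge0; lra.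
have QM1 : 1 <= (Q * M%:R) ^+ 2 by rewrite exprn_ege1 // mulr_ege1.
have [p1 p1P] : exists p1 : nat, (Q * M%:R) ^+ 2 <= (9 / 8 : R) ^+ p1.
  have [||k /andP[_ /ltW hk]] := @exists_log_floor R 2 ((Q * M%:R) ^+ 2) => //.
  (* The exponent 6 comes from [(9 / 8) ^ 6 >= 2]. *)
  exists (k.+1 * 6)%N; apply: le_trans hk _; rewrite mulnC exprM lerXn2r ?nnegrE //.
  by rewrite -subr_ge0; lra.
(* Chosen so that [p + 2 <= Dp * nu], by [n0 <= 2 * nu] and [1 <= nu]. *)
pose Dp : R := 2 * p1.+1%:R + 2.
pose W0 : R := 8 * ck * powR 2 s ^+ 2 * powR Dp s.
(* The constant is fixed before [A]. The threshold 1 excludes [K = 0]. *)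
exists (8 * (M%:R + 3) * W0) => A /set0Pn[a0 a0A] delta; exists 1%N => nu K nu1.
rewrite muln_gt0 => /andP[K0 M0].
have [n0 /andP[nu_n0 n0_nu]] : exists n0 : nat, nu <= n0%:R <= 2 * nu.
  have nu0 : 0 <= nu by lra.
  exists (Num.truncn nu).+1; rewrite ltW ?truncnS_gt //= -natr1.
  by have := truncn_le nu; rewrite nu0; lra.
have n01 : (0 < n0)%N by rewrite -(ltr_nat R) (lt_le_trans _ nu_n0) //; lra.
pose p := (p1.+1 * n0)%N.
have tpos : 0 < powR (M%:R : R) (- nu) by rewrite powR_gt0.
(* As [nu <= n0] and [Q >= 1], the left side is at most [(Q * M) ^ (2 * n0)]. *)
have hq : (Q / powR M%:R (- nu)) ^+ 2 <= (9 / 8) ^+ p.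
  apply: (@le_trans _ _ (((Q * M%:R) ^+ 2) ^+ n0)); last first.
    rewrite /p exprM lerXn2r ?nnegrE ?exprn_ge0 //; try lra.
    apply: le_trans p1P _; rewrite exprS ler_peMl ?exprn_ge0 //; lra.
  have L0 : 0 <= Q / powR M%:R (- nu) by apply: divr_ge0; [lra|exact: powR_ge0].
  rewrite -exprM mulnC exprM lerXn2r ?nnegrE ?exprn_ge0 //.
  rewrite powRN invrK exprMn; apply: ler_pM; [lra|exact: powR_ge0| |].
    by rewrite -[leLHS]expr1 ler_weXn2l.
  by rewrite -powR_mulrn ?(ltW M0') // ler_powR.
have W1 : 1 <= wscale s ck p by have := wscale_ge8 p s0 k1; lra.
have N0 : (0 < K * M)%N by rewrite muln_gt0 K0.
have [k] := card_near_cantor M2 a0A N0 W1; rewrite -/delta => hk.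
have p0 : (0 < p)%N by rewrite muln_gt0.
have := baker_eig_count_le M2 s0 hc supp C1 smo chi1 der k a0A K0 p0 tpos hq.
rewrite -(ler_nat R) natrM => /le_trans; apply.
apply: le_trans (ler_wpM2l _ hk) _ => //.
have lnM : 0 < ln (M%:R : R) by rewrite ln_gt0 // ltr1n.
have A1 : (1 <= #|A|)%N by rewrite card_gt0; apply/set0Pn; exists a0.
have AM : (#|A| <= M)%N by rewrite (leq_trans (max_card _)) // card_ord.
have de0 : 0 <= delta by rewrite divr_ge0 ?ln_ge0 ?ler1n // ltW.
have de1 : delta <= 1 by rewrite ler_pdivrMr // mul1r ler_ln ?posrE ?ltr0n // ler_nat.
have Dp1 : 1 <= Dp by rewrite /Dp; have : 0 <= p1.+1%:R :> R by []; lra.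
have W01 : 1 <= W0.
  have P1 := powR_ge1 Dp1 s0; have a2 : 1 <= powR (2 : R) s ^+ 2 by rewrite exprn_ege1.
  have k8 : 1 <= 8 * ck by lra.
  by rewrite /W0 mulr_ege1 // mulr_ege1.
have WW : wscale s ck p <= W0 * powR nu s.
  rewrite /W0 -mulrA -powRM; [|lra|lra].
  have pre0 : 0 <= 8 * ck * powR 2 s ^+ 2 by apply: mulr_ge0; [lra|exact: sqr_ge0].
  have Dnu0 : 0 <= Dp * nu by apply: mulr_ge0; lra.
  rewrite ler_wpM2l //; apply: ge0_ler_powR; rewrite ?nnegrE //.
  rewrite -addn2 natrD /p natrM /Dp.
  have : p1.+1%:R * n0%:R <= p1.+1%:R * (2 * nu) :> R by rewrite ler_wpM2l.
  by lra.
have fin : powR (wscale s ck p) (1 - delta) <= W0 * powR nu ((1 - delta) * s).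
  apply: (@le_trans _ _ (powR (W0 * powR nu s) (1 - delta))).
    have w0 : 0 <= wscale s ck p by lra.
    have Wnu0 : 0 <= W0 * powR nu s by exact: le_trans WW.
    by apply: ge0_ler_powR; rewrite ?nnegrE ?subr_ge0.
  rewrite powRM ?powR_ge0; [|lra|by []].
  rewrite -powRrM (mulrC s) ler_wpM2r ?powR_ge0 //.
  (* The power [1 - delta] of [W0] is at most [W0], which removes the dependence on [A]. *)
  rewrite -[leRHS]powRr1; last lra.
  by rewrite ler_powR //; lra.
apply: (@le_trans _ _ (8 * ((M%:R + 3) * powR (K * M)%:R delta *
   (W0 * powR nu ((1 - delta) * s))))).
  by rewrite ler_wpM2l // ler_wpM2l // mulr_ge0 ?powR_ge0 // addr_ge0.
by rewrite le_eqVlt; apply/orP; left; apply/eqP; ring.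
Qed.
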